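(* Let $p^1\in\mathbb{R}^2$ be a fixed point, and let $p^2,p^3\in\mathbb{R}^2$ be two points that are different from $p^1$ and satisfy $y_{p^1}>y_{p^2}$. Then $p^2\succ p^3$ (i.e. $p^2$ dominates $p^3$ relative to $p^1$) if and only if $y_{p^3}\le y_{p^2}$ and $$(y_{p^3}-y_{p^1})(x_{p^2}-x_{p^1})\ge(x_{p^3}-x_{p^1})(y_{p^2}-y_{p^1}).$$
   Context: A point $p\in\mathbb{R}^2$ has coordinates $(x_p,y_p)$, and $d_{pq}$ is the Euclidean distance. Fix a constant $B>0$. The energy metric is $J(p,q)=2B(d_{pq}+x_p-x_q)$ (the minimum energy needed to travel from $p$ to $q$ in the constant flow $(B,0)$). Given the fixed point $p^1$ and two points $p^2,p^3$ different from $p^1$, $p^2$ dominates $p^3$, written $p^2\succ p^3$, if $V(p^1\,|\,p^2)=V(p^1\,|\,p^2,p^3)$, where $V(p^1\,|\,p^2)=\{p\in\mathbb{R}^2 : J(p^1,p)\le J(p^2,p)\}$ and $V(p^1\,|\,p^2,p^3)=\{p\in\mathbb{R}^2 : J(p^1,p)\le J(p^2,p),\ J(p^1,p)\le J(p^3,p)\}$.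
   Formalization: The formal theorem additionally assumes that p^3 is not straight downstream of p^1 (not both y_{p^3}=y_{p^1} and x_{p^3}>x_{p^1}); in that case p^2 always dominates p^3 while y_{p^3}>y_{p^2}, so the equivalence as printed fails. *)

(* Defs.v *)
From Stdlib Require Import Reals Lra Ensembles.
Open Scope R_scope.

Definition point : Type := (R * R)%type.

Definition xc (p : point) : R := fst p.
Definition yc (p : point) : R := snd p.

Definition dist (p q : point) : R := dist_euc (xc p) (yc p) (xc q) (yc q).

(* Minimum energy needed to travel from [p] to [q] in the constant flow
   [(B, 0)]; not symmetric, and zero when [q] is straight downstream of [p]. *)
Definition J (B : R) (p q : point) : R := 2 * B * (dist p q + xc p - xc q).

(* V(p1 | p2) and V(p1 | p2, p3). *)
Definition V2 (B : R) (p1 p2 : point) : Ensemble point :=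
  fun p => J B p1 p <= J B p2 p.

Definition V3 (B : R) (p1 p2 p3 : point) : Ensemble point :=
  fun p => J B p1 p <= J B p2 p /\ J B p1 p <= J B p3 p.

Definition dominates (B : R) (p1 p2 p3 : point) : Prop :=
  Same_set point (V2 B p1 p2) (V3 B p1 p2 p3).

(* If [p3] is straight downstream of [p1], then [J B p1 p3 = 0], the triangle
   inequality gives [J B p1 p <= J B p3 p] for every [p], and so every [p2]
   dominates [p3], however [yc p2] compares with [yc p3]. *)
Lemma dominates_downstream (B : R) (p1 p2 p3 : point) :
  0 < B -> yc p3 = yc p1 -> xc p1 < xc p3 -> dominates B p1 p2 p3.
Proof.
intros HB Hy Hx.
split; intros p Hp; unfold In, V2, V3 in *; [split; [exact Hp|] | exact (proj1 Hp)].
unfold J, dist.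
assert (H := triangle (xc p1) (yc p1) (xc p) (yc p) (xc p3) (yc p3)).
assert (E : dist_euc (xc p1) (yc p1) (xc p3) (yc p3) = xc p3 - xc p1).
{ unfold dist_euc. rewrite Hy, Rminus_diag, Rsqr_0, Rplus_0_r.
  rewrite Rsqr_neg_minus. apply sqrt_Rsqr. lra. }
apply Rmult_le_compat_l; lra.
Qed.

(* Hence the characterization of domination by [yc p3 <= yc p2] and the slope
   inequality fails for such [p3] and must exclude them explicitly. *)
Lemma downstream_counterexample :
  ~ (forall (B : R) (p1 p2 p3 : point), 0 < B -> p2 <> p1 -> p3 <> p1 ->
     yc p1 > yc p2 ->
     (dominates B p1 p2 p3 <->
      yc p3 <= yc p2 /\
      (yc p3 - yc p1) * (xc p2 - xc p1) >= (xc p3 - xc p1) * (yc p2 - yc p1))).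
Proof.
intros H.
assert (D : dominates 1 (0, 0) (0, -1) (1, 0)).
{ apply dominates_downstream; simpl; lra. }
apply H in D; simpl in *; try lra; intros E; injection E; lra.
Qed.

(* Main.v *)
(** Put the origin at [p1] and use, for a point [p], the coordinate
    [y = yc p - yc p1] together with the excess
    [s = dist p1 p - (xc p - xc p1)], which is nonnegative and vanishes only
    straight downstream of [p1]. Every pair [(s, y)] with [0 < s] occurs, and in
    these coordinates the hyperbolic region [V2 B p1 q] becomes the half-plane
    [b * y - a * s <= b² / 2], where [(a, b) = q - p1]. Domination is thus the
    inclusion of one half-plane in another within [0 < s]. *)

From Stdlib Require Import Reals Lra Ensembles.
Require Import Defs.
Open Scope R_scope.

Definition excess (p q : point) : R := dist p q + xc p - xc q.

Lemma dist_ge0 (p q : point) : 0 <= dist p q.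
Proof. apply sqrt_pos. Qed.

Lemma dist_sqr (p q : point) :
  dist p q * dist p q = (xc q - xc p) ^ 2 + (yc q - yc p) ^ 2.
Proof.
unfold dist, dist_euc.
rewrite sqrt_sqrt by (apply Rplus_le_le_0_compat; apply Rle_0_sqr).
unfold Rsqr; ring.
Qed.

Lemma excess_ge0 (p q : point) : 0 <= excess p q.
Proof.
assert (Hr := dist_ge0 p q). assert (Hs := dist_sqr p q).
unfold excess.
apply Rnot_lt_le; intros H.
assert (dist p q * dist p q < (xc q - xc p) * (xc q - xc p)).
{ apply Rmult_le_0_lt_compat; lra. }
assert (0 <= (yc q - yc p) ^ 2) by apply pow2_ge_0.
lra.
Qed.

Lemma excess_surj (p : point) (s y : R) :
  0 < s -> exists q, excess p q = s /\ yc q - yc p = y.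
Proof.
intros Hs.
(* The abscissa solves [sqrt (x² + y²) - x = s] for [x]; the distance is then [(y² / s + s) / 2]. *)
exists (xc p + (y ^ 2 / s - s) / 2, yc p + y).
split; [|cbn; ring].
assert (Hy : 0 <= y ^ 2 / s).
{ apply Rmult_le_pos; [apply pow2_ge_0 | left; now apply Rinv_0_lt_compat]. }
unfold excess, dist, dist_euc, xc, yc; cbn [fst snd].
replace (Rsqr (fst p - (fst p + (y ^ 2 / s - s) / 2)) + Rsqr (snd p - (snd p + y)))
  with (Rsqr ((y ^ 2 / s + s) / 2)) by (unfold Rsqr; field; lra).
rewrite sqrt_Rsqr by lra.
lra.
Qed.

(** Dividing by [2 * B] leaves [r - a <= t] between distances; when [r > a] it can be squared, and
    the quadratic terms in [p] cancel. *)
Lemma J_le_half_plane (B : R) (p1 q p : point) :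
  0 < B ->
  J B p1 p <= J B q p <->
  (yc q - yc p1) * (yc p - yc p1) - (xc q - xc p1) * excess p1 p
    <= (yc q - yc p1) ^ 2 / 2.
Proof.
intros HB.
assert (Hrp := dist_ge0 p1 p). assert (Hrs := dist_sqr p1 p).
assert (Htp := dist_ge0 q p). assert (Hts := dist_sqr q p).
assert (Hs := excess_ge0 p1 p).
assert (HJ : J B p1 p <= J B q p <-> dist p1 p - (xc q - xc p1) <= dist q p).
{ unfold J; split; intros H.
  - apply Rmult_le_reg_l in H; lra.
  - apply Rmult_le_compat_l; lra. }
rewrite HJ; clear HJ; unfold excess in *.
set (r := dist p1 p) in *. set (t := dist q p) in *.
set (a := xc q - xc p1). set (b := yc q - yc p1).
replace (xc p - xc q) with (xc p - xc p1 - a) in Hts by (unfold a; ring).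
replace (yc p - yc q) with (yc p - yc p1 - b) in Hts by (unfold b; ring).
replace (r + xc p1 - xc p) with (r - (xc p - xc p1)) in * by ring.
set (x := xc p - xc p1) in *. set (y := yc p - yc p1) in *.
destruct (Rle_or_lt r a) as [Hra|Hra].
- (* Both sides hold: [y² = (r - x) * (r + x) <= 2 * a * (r - x)], and
     [2 * b * y <= b² + y²]. *)
  split; intros _; [|lra].
  assert (y ^ 2 <= 2 * (a * (r - x))) by nra.
  assert (0 <= (b - y) ^ 2) by apply pow2_ge_0.
  lra.
- split; intros H.
  + assert ((r - a) * (r - a) <= t * t) by (apply Rmult_le_compat; lra). lra.
  + apply Rsqr_incr_0; unfold Rsqr; lra.
Qed.

Lemma dominates_iff (B : R) (p1 p2 p3 : point) :
  0 < B ->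
  dominates B p1 p2 p3 <->
  (forall p, J B p1 p <= J B p2 p -> J B p1 p <= J B p3 p).
Proof.
intros HB; unfold dominates, Same_set, Included, In, V2, V3.
firstorder.
Qed.

(** Large [s] forces the sign of [k], small [s] that of [e]. *)
Lemma linear_bound_pos (k e : R) :
  (forall s, 0 < s -> k * s <= e) -> k <= 0 /\ 0 <= e.
Proof.
intros H; split.
- apply Rnot_lt_le; intros Hk.
  assert (Hs : 0 < (Rabs e + 1) / k).
  { apply Rdiv_lt_0_compat; [assert (H0 := Rabs_pos e)|]; lra. }
  apply H in Hs.
  replace (k * ((Rabs e + 1) / k)) with (Rabs e + 1) in Hs by (field; lra).
  assert (H0 := Rle_abs e); lra.
- apply Rnot_lt_le; intros He.
  assert (Hd : 0 < Rabs k + 1) by (assert (H0 := Rabs_pos k); lra).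
  assert (Hs : 0 < - e / (Rabs k + 1)) by (apply Rdiv_lt_0_compat; lra).
  assert (Hk := H _ Hs).
  assert (E : (Rabs k + 1) * (- e / (Rabs k + 1)) = - e) by (field; lra).
  assert (- Rabs k <= k) by (assert (H0 := Rle_abs (- k)); rewrite Rabs_Ropp in H0; lra).
  nra.
Qed.

(** Testing the inclusion along the boundary of the first half-plane suffices, once [d < 0] is
    known. If [d = 0] and [c >= 0], the second half-plane contains all of [0 < s], whence the second
    hypothesis. *)
Lemma half_plane_incl (a b c d : R) :
  b < 0 -> (d = 0 -> c < 0) ->
  (forall s y, 0 < s -> b * y - a * s <= b ^ 2 / 2 -> d * y - c * s <= d ^ 2 / 2) ->
  d <= b /\ c * b <= d * a.
Proof.
intros Hb Hd H.
(* At [t = 0] the point is on the boundary line; as [b < 0], raising [y] by [t] stays inside. *)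
assert (Hray : forall s t, 0 < s -> 0 <= t ->
  d * (b / 2 + a * s / b + t) - c * s <= d ^ 2 / 2).
{ intros s t Hs Ht. apply H; [exact Hs|].
  replace (b * (b / 2 + a * s / b + t) - a * s) with (b ^ 2 / 2 + b * t) by (field; lra).
  nra. }
assert (Hd0 : d <= 0).
{ apply (linear_bound_pos d (d ^ 2 / 2 + c - d * (b / 2 + a * 1 / b))).
  intros t Ht.
  assert (H1 := Hray 1 t ltac:(lra) ltac:(lra)). lra. }
assert (Hd1 : d < 0).
{ destruct Hd0 as [|E]; [assumption|].
  specialize (Hd E). assert (H1 := Hray 1 0 ltac:(lra) ltac:(lra)). rewrite E in H1. lra. }
destruct (linear_bound_pos (d * a / b - c) (d * (d - b) / 2)) as [Hk He].
{ intros s Hs. assert (H1 := Hray s 0 Hs ltac:(lra)).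
  replace (d * (b / 2 + a * s / b + 0)) with (d * b / 2 + d * a / b * s) in H1 by (field; lra).
  lra. }
split; [nra|].
assert (E : d * a / b * b = d * a) by (field; lra).
nra.
Qed.

Theorem corollary1 (B : R) (p1 p2 p3 : point)
  (hB : 0 < B)
  (h2 : p2 <> p1) (h3 : p3 <> p1)
  (hy : yc p1 > yc p2)
  (hdown : ~ (yc p3 = yc p1 /\ xc p1 < xc p3)) :
  dominates B p1 p2 p3 <->
  (yc p3 <= yc p2 /\
   (yc p3 - yc p1) * (xc p2 - xc p1) >= (xc p3 - xc p1) * (yc p2 - yc p1)).
Proof.
rewrite dominates_iff by exact hB.
split.
- intros H.
  destruct (half_plane_incl (xc p2 - xc p1) (yc p2 - yc p1)
              (xc p3 - xc p1) (yc p3 - yc p1)) as [Hd Hac].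
  + lra.
  (* When [p3] is level with [p1], [h3] and [hdown] leave only the upstream side. *)
  + intros E.
    destruct (Rtotal_order (xc p3) (xc p1)) as [Hx|[Hx|Hx]].
    * lra.
    * destruct h3. apply injective_projections; [exact Hx | unfold yc in E; lra].
    * destruct hdown; lra.
  + intros s y Hs.
    destruct (excess_surj p1 s y Hs) as [p [<- <-]].
    rewrite <- !(J_le_half_plane B) by exact hB.
    apply H.
  + lra.
- intros [Hd Hac] p.
  rewrite !J_le_half_plane by exact hB.
  assert (Hs := excess_ge0 p1 p).
  generalize dependent (excess p1 p); intros s Hs.
  set (y := yc p - yc p1).
  set (a := xc p2 - xc p1) in *. set (c := xc p3 - xc p1) in *.
  assert (Hb : yc p2 - yc p1 < 0) by lra.
  assert (Hdb : yc p3 - yc p1 <= yc p2 - yc p1) by lra.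
  set (b := yc p2 - yc p1) in *. set (d := yc p3 - yc p1) in *.
  intros H.
  (* Scale the hypothesis by [d / b >= 1], with denominators cleared. *)
  assert (H1 : - d * (b * y - a * s) <= - d * (b ^ 2 / 2)) by (apply Rmult_le_compat_l; lra).
  (* [H2] replaces [d * a] by [c * b] in the coefficient of [s]; [H3] weakens the bound from
     [- d * b² / 2] to [- b * d² / 2]. *)
  assert (H2 : 0 <= (d * a - c * b) * s) by (apply Rmult_le_pos; lra).
  assert (H3 : 0 <= (b * d) * (b - d)) by (apply Rmult_le_pos; nra).
  apply Rmult_le_reg_l with (- b); [lra|].
  lra.
Qed.
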